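(* Let $p_n\in(0,1]$ with $\lim_{n\to\infty}np_n=\infty$. For every $n\in\mathbb N$ let $\{\xi^{(n)}_{ij}\}_{1\le i\ne j\le n}$ be IID Bernoulli random variables with parameter $p_n$, and set $\xi^{(n)}_{ii}=0$ for all $i$ (Erdős–Rényi random graphs). Then, $\mathbb P$-almost surely, $$\lim_{n\to\infty}\ \sup_{s_i,t_j\in\{-1,1\}}\ \frac1{n^2}\sum_{i,j=1}^n\Big(\frac{\xi^{(n)}_{ij}}{p_n}-1\Big)s_it_j=0.$$
   Context: All the variables $\xi^{(n)}_{ij}$, $n\in\mathbb N$, are defined on a common probability space with probability $\mathbb P$. The graphs are directed: $\xi^{(n)}_{ij}$ and $\xi^{(n)}_{ji}$ are independent for $i\neq j$. The supremum is over all $(s_1,\dots,s_n),(t_1,\dots,t_n)\in\{-1,1\}^n$. *)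

(* Defs.v *)
From HB Require Import structures.
From mathcomp Require Import all_boot all_order all_algebra finmap.
From mathcomp Require Import all_classical all_reals all_analysis.

Set Implicit Arguments.
Unset Strict Implicit.
Unset Printing Implicit Defensive.

Import Order.TTheory GRing.Theory Num.Theory.
Import numFieldNormedType.Exports.

Local Open Scope classical_set_scope.
Local Open Scope ring_scope.

Definition mutually_independent d d' (T : measurableType d)
    (T' : measurableType d') (R : realType) (P : probability T R)
    (I : choiceType) (D : set I) (X : I -> {RV P >-> T'}) : Prop :=
  forall (J : {fset I}) (A : I -> set T'),
    [set` J] `<=` D ->
    (forall i, measurable (A i)) ->
    (P (\bigcap_(i in [set` J]) (X i @^-1` A i)) =
     \prod_(i <- J) P (X i @^-1` A i))%E.

Definition sign_vectors (R : realType) (n : nat) : set ('I_n -> R) :=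
  [set s | forall i, s i = -1 \/ s i = 1].
Arguments sign_vectors : clear implicits.

(* The indices 1..n are represented by 'I_n, and an edge indicator is a
   bool-valued random variable, [true] standing for 1.  No independence is
   required between graphs of different sizes. *)
Definition directed_erdos_renyi d (T : measurableType d) (R : realType)
    (P : probability T R) (n : nat) (p : R)
    (xi : 'I_n -> 'I_n -> {RV P >-> bool}) : Prop :=
  [/\ mutually_independent [set ij : 'I_n * 'I_n | ij.1 != ij.2]
        (fun ij => xi ij.1 ij.2),
      forall (i j : 'I_n), i != j ->
        forall A : set bool, distribution P (xi i j) A = bernoulli_prob p A
    & forall (i : 'I_n) (w : T), xi i i w = false].

(* Main.v *)
Require Import Defs.
From HB Require Import structures.
From mathcomp Require Import all_boot all_order all_algebra finmap.
From mathcomp Require Import all_classical all_reals all_analysis.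
From mathcomp Require Import ring lra.

Set Implicit Arguments.
Unset Strict Implicit.
Unset Printing Implicit Defensive.

Import Order.TTheory GRing.Theory Num.Theory.
Import numFieldNormedType.Exports.

Local Open Scope classical_set_scope.
Local Open Scope ring_scope.

(** For fixed signs [s] and [t], the tilted moments of a centred Bernoulli
    variable satisfy [E exp (u (xi - p)) <= exp (2 p u^2)] for [|u| <= 1/2], so
    Chernoff's bound with [u = e / 4] shows that the off-diagonal sum exceeds
    [e n^2] with probability at most [exp (- e^2 p_n n^2 / 8)].  There are only
    [4 ^ n] choices of signs, and [n p_n] tends to infinity, so the union bound
    is eventually below [2 ^ - n] and Borel-Cantelli applies to each
    [e = 1 / (k + 1)].  The diagonal contributes at most [1 / n].

    Since everything depends on finitely many bits, the Chernoff bound is a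
    finite computation: the event is covered by the atoms fixing all the bits,
    and the expectation is a sum over these atoms. *)

(** * Tilted moments of a centred Bernoulli variable *)

(** Since [1 - u <= expR (- u)], one has [expR u <= 1 / (1 - u)], and [(1 - u) (1 + u + 2 u^2) = 1 +
    u^2 (1 - 2 u)] is at least 1. *)
Lemma expR_le_quadratic (R : realType) (u : R) :
  `|u| <= 2^-1 -> expR u <= 1 + u + 2 * u ^+ 2.
Proof.
rewrite ler_norml => /andP[u1 u2].
have h : 1 - u <= expR (- u) by exact: expR_ge1Dx.
have u0 : 0 < 1 - u by lra.
have : expR u <= (1 - u)^-1.
  by rewrite -[expR u]invrK -expRN lef_pV2 ?posrE ?expR_gt0.
move=> /le_trans; apply; rewrite -div1r ler_pdivrMr//.
have := mulr_ge0 (sqr_ge0 u) (_ : 0 <= 1 - 2 * u); nra.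
Qed.

Definition bernoulli_weight (R : realType) (p : R) (b : bool) : R :=
  if b then p else 1 - p.

(** Apply [1 + x <= expR x] to [x = p (expR u - 1)]; the linear term [p u] cancels against the
    centring. Keeping the factor [p] in the exponent, of the order of the variance, is what makes
    the bound strong enough for sparse graphs. *)
Lemma bernoulli_mgf_le (R : realType) (p u : R) : 0 <= p <= 1 ->
  `|u| <= 2^-1 ->
  \sum_(b : bool) bernoulli_weight p b * expR (u * (b%:R - p))
    <= expR (2 * p * u ^+ 2).
Proof.
move=> /andP[p0 p1] hu; rewrite big_bool /=.
rewrite sub0r mulrN mulrBr mulr1 expRD.
rewrite (_ : p * (expR u * expR (- (u * p))) + (1 - p) * expR (- (u * p)) =
             (1 + p * (expR u - 1)) * expR (- (u * p))); last by ring.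
apply: (@le_trans _ _ (expR (p * (u + 2 * u ^+ 2)) * expR (- (u * p)))).
  rewrite ler_wpM2r ?expR_ge0// (le_trans (expR_ge1Dx _))// ler_expR.
  by rewrite ler_wpM2l//; have := expR_le_quadratic hu; lra.
by rewrite -expRD ler_expR; lra.
Qed.

(** * Chernoff's bound for independent Bernoulli variables *)

Lemma measure_bigcup_pred_le (d : measure_display) (T : measurableType d)
    (R : realType) (mu : {measure set T -> \bar R}) (I : finType) (Q : {pred I})
    (F : I -> set T) : (forall i, measurable (F i)) ->
  (mu (\bigcup_(i in [set` Q]) F i) <= \sum_(i in Q) mu (F i))%E.
Proof.
move=> mF; rewrite bigcup_pred; elim: (index_enum I) => [|i r ih].
  by rewrite !big_nil measure0.
rewrite !big_cons; case: ifP => // _.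
apply: (@le_trans _ _
    (mu (F i) + mu (\big[setU/set0]_(j <- r | j \in Q) F j))%E).
  by apply: measureU2 => //; exact: bigsetU_measurable.
exact: leeD2l.
Qed.

Section independent_bernoulli.
Context (d : measure_display) (T : measurableType d) (R : realType)
  (P : probability T R) (I : finType) (D : pred I) (X : I -> {RV P >-> bool})
  (p : R).
Context (p01 : 0 <= p <= 1)
  (indepX : mutually_independent [set i | D i] X)
  (lawX : forall i, D i ->
    forall A : set bool, distribution P (X i) A = bernoulli_prob p A).

Let atom (f : {ffun I -> bool}) : set T :=
  \bigcap_(i in [set i | D i]) (X i @^-1` [set f i]).

Let measurable_atom f : measurable (atom f).
Proof.
apply: fin_bigcap_measurable => // i _.
rewrite -[X in measurable X]setTI; exact: measurable_funPT.
Qed.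

Let probability_atom f :
  P (atom f) = (\prod_(i | D i) bernoulli_weight p (f i))%:E.
Proof.
(* Independence is stated over finite sets, so [D] is turned into one and the product is then
   reindexed. *)
pose J : {fset I} := [fset i in D]%fset.
have JD : [set` J] = [set i | D i].
  by apply/seteqP; split => i /=; rewrite !inE.
rewrite /atom -JD.
rewrite (indepX (J := J) (A := fun i => [set f i]))//; last by rewrite JD.
rewrite -prodEFin -[RHS]big_filter.
rewrite -(@perm_big _ _ _ _ [seq i <- index_enum I | D i] J) ?big_filter/=; last first.
  apply: uniq_perm; [exact/filter_uniq/index_enum_uniq|exact: fset_uniq|].
  by move=> i; rewrite mem_filter mem_index_enum !inE andbT.
apply: eq_bigr => i Di.
rewrite -[LHS]/(distribution P (X i) [set f i]) lawX// bernoulli_probE//.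
rewrite !diracE /bernoulli_weight; case: (f i).
  rewrite mem_set// memNset//= ?mule0 ?mule1 ?adde0//.
by rewrite memNset// mem_set//= ?mule0 ?mule1 ?add0e.
Qed.

Lemma measurable_bernoulli_deviation (u : I -> R) (a : R) :
  measurable [set w | a <= \sum_(i | D i) u i * ((X i w)%:R - p)].
Proof.
pose S w := \sum_i (if D i then u i * ((X i w)%:R - p) else 0).
have mS : measurable_fun setT S.
  apply: measurable_sum => i; case: (D i); last exact: measurable_cst.
  by apply: (@measurableT_comp _ _ _ _ _ _ (fun b : bool => u i * (b%:R - p))).
rewrite (_ : [set w | _] = setT `&` S @^-1` `[a, +oo[); first exact: mS.
rewrite setTI; apply/seteqP; split => w /=;
  by rewrite in_itv /= andbT /S -big_mkcond.
Qed.

(** The tilt parameter is absorbed into the coefficients [u], whence the bound [1/2] on them. *)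
Lemma bernoulli_chernoff (u : I -> R) (a : R) :
  (forall i, D i -> `|u i| <= 2^-1) ->
  (P [set w | (a <= \sum_(i | D i) u i * ((X i w)%:R - p))%R] <=
     (expR (\sum_(i | D i) 2 * p * u i ^+ 2 - a))%:E)%E.
Proof.
move=> hu; have /andP[p0 p1] := p01.
pose S (f : {ffun I -> bool}) := \sum_(i | D i) u i * ((f i)%:R - p).
(* Requiring [f] to be [false] off [D] selects one representative of each atom, so that no atom is
   counted twice. *)
pose good := [pred f : {ffun I -> bool} |
  (f \in pffun_on false D predT) && (a <= S f)].
apply: (@le_trans _ _ (P (\bigcup_(f in [set` good]) atom f))).
  apply: le_measure; rewrite ?inE.
  - exact: measurable_bernoulli_deviation.
  - by apply: fin_bigcup_measurable => //; exact: finite_finset.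
  move=> w /= hw; exists [ffun i => D i && X i w] => [|i /= Di]; last first.
    by rewrite ffunE Di.
  apply/andP; split => /=.
    apply/pffun_onP; split => //; apply/supportP => i /negbTE Di.
    by rewrite ffunE -[D i]/(i \in D) Di.
  by rewrite /S; under eq_bigr => i Di do rewrite ffunE Di.
apply: (le_trans (measure_bigcup_pred_le _ _ _)) => //.
rewrite (eq_bigr _ (fun f _ => probability_atom f)).
rewrite sumEFin lee_fin.
pose W f := \prod_(i | D i)
  (bernoulli_weight p (f i) * expR (u i * ((f i)%:R - p))).
(* Markov's inequality on atoms: [W f * expR (- a)] is the probability of the atom times
   [expR (S f - a)], a factor at least 1 when [f] is good; the other terms are nonnegative. *)
apply: (@le_trans _ _ (\sum_(f in pffun_on false D predT) W f * expR (- a))).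
  rewrite /good big_mkcondr/=; apply: ler_sum => f _.
  rewrite /W big_split /= -expR_sum -mulrA -expRD -/(S f).
  have w0 : 0 <= \prod_(i | D i) bernoulli_weight p (f i).
    by apply: prodr_ge0 => i _; rewrite /bernoulli_weight; case: ifP => _; lra.
  case: ifPn => [aS|_]; last by rewrite mulr_ge0 ?expR_ge0.
  by rewrite ler_peMr// -expR0 ler_expR subr_ge0.
rewrite -mulr_suml expRD ler_wpM2r ?expR_ge0//.
(* Distributivity turns the sum over [f] into the product of the individual tilted moments. *)
rewrite -(big_distr_big false D predT
  (fun i b => bernoulli_weight p b * expR (u i * (b%:R - p)))).
rewrite expR_sum; apply: ler_prod => i Di; rewrite bernoulli_mgf_le ?hu// andbT.
apply: sumr_ge0 => b _; rewrite mulr_ge0 ?expR_ge0// /bernoulli_weight.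
by case: ifP => _; lra.
Qed.

End independent_bernoulli.

(** * Borel-Cantelli *)

(** Summability makes [lim_sup_set F] null, and a point outside it lies in only finitely many
    [F n]. *)
Lemma ae_eventually_notin (d : measure_display) (T : measurableType d)
    (R : realType) (mu : {measure set T -> \bar R}) (F : (set T)^nat) :
  (forall n, measurable (F n)) -> (\sum_(n <oo) mu (F n) < +oo)%E ->
  {ae mu, forall w, \forall n \near \oo, ~ F n w}.
Proof.
move=> mF Foo; exists (lim_sup_set F); split.
- by apply: bigcap_measurable => // k _; exact: bigcup_measurable.
- exact: lim_sup_set_cvg0.
move=> w /= Fw n _; apply: contrapT => hn; apply: Fw; exists n => // m /= nm Fm.
by apply: hn; exists m.
Qed.

(** * Union bound over the signs *)

Section discrepancy.
Context (d : measure_display) (T : measurableType d) (R : realType)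
  (P : probability T R).

(** This is [p] times the off-diagonal part of the sum in the theorem. Signs are encoded by booleans
    so that the sign vectors form a finite type, as the union bound requires. *)
Definition discrepancy (n : nat) (p : R) (xi : 'I_n -> 'I_n -> {RV P >-> bool})
    (st : {ffun 'I_n -> bool} * {ffun 'I_n -> bool}) (w : T) : R :=
  \sum_(ij : 'I_n * 'I_n | ij.1 != ij.2)
    (-1) ^+ st.1 ij.1 * (-1) ^+ st.2 ij.2 * ((xi ij.1 ij.2 w)%:R - p).

Definition large_discrepancy (n : nat) (p : R)
    (xi : 'I_n -> 'I_n -> {RV P >-> bool}) (e : R) : set T :=
  [set w | exists st, e * p * n%:R ^+ 2 <= discrepancy p xi st w].

Lemma large_discrepancyE n p (xi : 'I_n -> 'I_n -> {RV P >-> bool}) e :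
  large_discrepancy p xi e =
  \bigcup_(st in [set` predT])
    [set w | e * p * n%:R ^+ 2 <= discrepancy p xi st w].
Proof. by apply/seteqP; split => w [st]; [|move=> _]; exists st. Qed.

Lemma measurable_discrepancy n p (xi : 'I_n -> 'I_n -> {RV P >-> bool}) st c :
  measurable [set w | c <= discrepancy p xi st w].
Proof. exact: (measurable_bernoulli_deviation _ (fun ij => xi ij.1 ij.2)). Qed.

Lemma measurable_large_discrepancy n p
    (xi : 'I_n -> 'I_n -> {RV P >-> bool}) e :
  measurable (large_discrepancy p xi e).
Proof.
rewrite large_discrepancyE; apply: fin_bigcup_measurable => [|st _].
  exact: finite_finset.
exact: measurable_discrepancy.
Qed.

Lemma probability_large_discrepancy_le n p
    (xi : 'I_n -> 'I_n -> {RV P >-> bool}) e :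
  0 <= p <= 1 -> 0 < e <= 1 -> directed_erdos_renyi p xi ->
  (P (large_discrepancy p xi e) <=
    (4 ^+ n * expR (- (e ^+ 2 / 8 * p * n%:R ^+ 2)))%:E)%E.
Proof.
move=> p01 /andP[e0 e1] [ind law _]; have /andP[p0 p1] := p01.
rewrite large_discrepancyE; apply: (le_trans (measure_bigcup_pred_le _ _ _)).
  by move=> st; exact: measurable_discrepancy.
apply: (@le_trans _ _ (\sum_(st in
    @predT ({ffun 'I_n -> bool} * {ffun 'I_n -> bool})%type)
    (expR (- (e ^+ 2 / 8 * p * n%:R ^+ 2)))%:E)%E); last first.
  rewrite sumEFin sumr_const lee_fin -[leLHS]mulr_natl.
  by rewrite card_prod !card_ffun card_bool card_ord -expnMn natrX.
apply: lee_sum => st _.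
(* The tilt [x = e / 4] minimises the exponent [2 p x^2 n^2 - x e p n^2], with value
   [- e^2 p n^2 / 8]; it is below [1/2] because [e <= 1]. *)
pose u ij := e / 4 * ((-1) ^+ st.1 ij.1 * (-1) ^+ st.2 ij.2).
have u2 ij : u ij ^+ 2 = (e / 4) ^+ 2 by rewrite /u !exprMn !sqrr_sign !mulr1.
pose a := e / 4 * (e * p * n%:R ^+ 2).
rewrite (_ : [set w | _] = [set w | a <=
    \sum_(ij | ij.1 != ij.2) u ij * ((xi ij.1 ij.2 w)%:R - p)]); last first.
  apply/funext => w /=; congr is_true; rewrite /a /u.
  under [in RHS]eq_bigr do rewrite -mulrA.
  by rewrite -mulr_sumr ler_pM2l// divr_gt0.
apply: le_trans (bernoulli_chernoff p01 ind _ _ _) _.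
- by move=> ij; exact: law.
- move=> ij _; rewrite /u !normrM !normr_sign !mulr1 !gtr0_norm//; lra.
rewrite lee_fin ler_expR.
under eq_bigr do rewrite u2.
rewrite sumr_const -[X in X - _]mulr_natl /a.
have : #|[pred ij : 'I_n * 'I_n | ij.1 != ij.2]|%:R <= n%:R ^+ 2 :> R.
  rewrite -natrX ler_nat (leq_trans (max_card _))// card_prod card_ord.
  by rewrite mulnn.
move=> /(ler_wpM2r (_ : 0 <= 2 * p * (e / 4) ^+ 2)) => /(_ _)/le_trans hD.
rewrite lerBlDr; apply: hD; last by lra.
by rewrite mulr_ge0 ?sqr_ge0// mulr_ge0.
Qed.

End discrepancy.

(** * Almost sure smallness of the off-diagonal sums *)

Lemma discrepancy_eventually_small (d : measure_display) (T : measurableType d)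
    (R : realType) (P : probability T R) (p : nat -> R)
    (xi : forall n : nat, 'I_n -> 'I_n -> {RV P >-> bool}) (e : R) :
  (forall n : nat, (0 < n)%N -> 0 < p n <= 1) ->
  (fun n : nat => n%:R * p n) @ \oo --> +oo ->
  (forall n : nat, (0 < n)%N -> directed_erdos_renyi (p n) (@xi n)) ->
  0 < e <= 1 ->
  {ae P, forall w, \forall n \near \oo, forall st,
    discrepancy (p n) (@xi n) st w < e * p n * n%:R ^+ 2}.
Proof.
move=> hp hnp hxi e01; have /andP[e0 e1] := e01.
have e2 : 0 < e ^+ 2 / 8 by rewrite divr_gt0// exprn_gt0.
(* The constant 7 gives [expR (- 7) <= 1 / (1 + 7)], so each of the [n] factors of the union bound
   is at most [4 / 8 = 1 / 2]. *)
have [N _ hN] : \forall n \near \oo, 7 / (e ^+ 2 / 8) <= n%:R * p n.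
  by move/cvgryPge : hnp; exact.
(* The shift by [N.+1] makes the geometric bound hold from index 0 on and keeps the graph size
   positive. *)
pose F n := large_discrepancy (p (n + N.+1)%N) (@xi (n + N.+1)%N) e.
have mF n : measurable (F n) by exact: measurable_large_discrepancy.
have PF n : (P (F n) <= (1 / (2 ^ (n + 1))%:R)%:E)%E.
  rewrite /F; move: (leq_addl n N.+1); set m := (n + N.+1)%N => Nm.
  have m0 : (0 < m)%N by rewrite (leq_trans _ Nm).
  have /andP[pm0 pm1] := hp m m0.
  apply: le_trans (probability_large_discrepancy_le _ e01 (hxi m m0)) _.
    by rewrite ltW.
  rewrite lee_fin.
  have hm : 7 <= e ^+ 2 / 8 * (m%:R * p m).
    by rewrite -ler_pdivrMl// mulrC; apply: hN; exact: ltnW.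
  rewrite (_ : - _ = - (e ^+ 2 / 8 * (m%:R * p m)) * m%:R); last by ring.
  rewrite expRM_natr -exprMn.
  have h8 : expR (- (e ^+ 2 / 8 * (m%:R * p m))) <= 8^-1.
    rewrite expRN lef_pV2 ?posrE ?expR_gt0//.
    by apply: le_trans (expR_ge1Dx _); lra.
  apply: (@le_trans _ _ (2^-1 ^+ m)).
    rewrite lerXn2r ?nnegrE ?mulr_ge0 ?expR_ge0//; lra.
  rewrite natrX div1r -exprVn; apply: ler_wiXn2l; rewrite ?invr_ge0 ?invf_le1//.
    by rewrite ler1n.
  by rewrite /m leq_add2l.
have sumF : (\sum_(n <oo) P (F n) < +oo)%E.
  apply: (@le_lt_trans _ _ (\sum_(n <oo) (1 / (2 ^ (n + 1))%:R)%:E)%E).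
    by apply: lee_nneseries => n *; [exact: measure_ge0|exact: PF].
  by rewrite (cvg_lim _ (@cvg_geometric_eseries_half R 1 0))// ltry.
apply: filterS (ae_eventually_notin mF sumF) => w [M _ hM].
exists (M + N.+1)%N => // n /= Mn st; rewrite ltNge; apply/negP => hst.
have Nn : (N.+1 <= n)%N by rewrite (leq_trans _ Mn)// leq_addl.
apply: (hM (n - N.+1)%N); first by rewrite /= leq_subRL// addnC.
by rewrite /F subnK//; exists st.
Qed.

(** * From the off-diagonal sums to the supremum *)

Lemma sign_vectorsN (R : realType) n (s : 'I_n -> R) :
  sign_vectors R n s -> sign_vectors R n (fun i => - s i).
Proof. by move=> hs i; case: (hs i) => ->; rewrite ?opprK; [right|left]. Qed.

Lemma sign_vectors_signr (R : realType) n (s : 'I_n -> R) :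
  sign_vectors R n s ->
  exists f : {ffun 'I_n -> bool}, forall i, s i = (-1) ^+ f i.
Proof.
move=> hs; exists [ffun i => s i == -1] => i; rewrite ffunE.
by case: (hs i) => ->; rewrite ?eqxx// gt_eqF//; lra.
Qed.

(** The off-diagonal terms contribute at most [e n^2]. On the diagonal the centring [-1] remains
    although [xi i i] vanishes: these [n] terms are each at most 1, which gives [1 / n] after
    division by [n^2]. *)
Lemma bilinear_form_le (d : measure_display) (T : measurableType d)
    (R : realType) (P : probability T R) (n : nat) (p e : R)
    (xi : 'I_n -> 'I_n -> {RV P >-> bool}) (w : T) : (0 < n)%N -> 0 < p ->
  (forall i w, xi i i w = false) ->
  (forall st, discrepancy p xi st w < e * p * n%:R ^+ 2) ->
  forall s t, sign_vectors R n s -> sign_vectors R n t ->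
  (n%:R ^+ 2)^-1 * \sum_(i < n) \sum_(j < n)
     ((xi i j w)%:R / p - 1) * s i * t j <= e + n%:R^-1.
Proof.
move=> n0 p0 xi0 hw s t /sign_vectors_signr[f sf] /sign_vectors_signr[g tg].
have n0' : 0 < n%:R :> R by rewrite ltr0n.
rewrite mulrC ler_pdivrMr ?exprn_gt0//.
rewrite pair_bigA /= (bigID (fun ij : 'I_n * 'I_n => ij.1 != ij.2)) /=.
rewrite mulrDl expr2 mulKf ?gt_eqF//; apply: lerD.
  have := hw (f, g); rewrite /discrepancy /= => hfg.
  rewrite -expr2 -(ler_pM2l p0) mulrCA mulrA.
  apply/ltW; apply: le_lt_trans hfg; rewrite mulr_sumr le_eqVlt; apply/orP; left; apply/eqP.
  apply: eq_bigr => ij _; rewrite sf tg.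
  by field; rewrite gt_eqF.
apply: (@le_trans _ _ (\sum_(ij : 'I_n * 'I_n | ~~ (ij.1 != ij.2)) 1)).
  apply: ler_sum => -[i j] /=; rewrite negbK => /eqP <-.
  rewrite xi0 mul0r sub0r sf tg.
  by case: (f i); case: (g i); rewrite ?expr0 ?expr1; lra.
rewrite (eq_bigl (fun ij => xpredT ij.1 && (ij.2 == ij.1))) => [|ij]; last first.
  by rewrite negbK eq_sym.
rewrite -(pair_big_dep xpredT (fun i j => j == i) (fun _ _ => 1)) /=.
under eq_bigr do rewrite big_pred1_eq.
by rewrite sumr_const card_ord.
Qed.

Theorem propositionA4 (d : measure_display) (T : measurableType d)
    (R : realType) (P : probability T R) (p : nat -> R)
    (xi : forall n : nat, 'I_n -> 'I_n -> {RV P >-> bool})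
    (hp : forall n : nat, (0 < n)%N -> 0 < p n <= 1)
    (hnp : (fun n : nat => n%:R * p n) @ \oo --> +oo)
    (hxi : forall n : nat, (0 < n)%N -> directed_erdos_renyi (p n) (@xi n)) :
  {ae P, forall w : T,
    (fun n : nat =>
       sup [set (n%:R ^+ 2)^-1 *
                  \sum_(i < n) \sum_(j < n)
                     ((xi n i j w)%:R / p n - 1) * s i * t j
           | s in sign_vectors R n & t in sign_vectors R n])
      @ \oo --> (0 : R)}.
Proof.
(* Restricting to the countably many thresholds [1 / (k + 1)] allows one null set to serve all of
   them. *)
have small : {ae P, forall w, forall k : nat, \forall n \near \oo, forall st,
    discrepancy (p n) (@xi n) st w < k.+1%:R^-1 * p n * n%:R ^+ 2}.
  apply: ae_foralln => k; apply: discrepancy_eventually_small => //.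
  by rewrite invr_gt0 ltr0n invf_le1 ?ltr0n// ler1n.
apply: filterS small => w hw; apply/cvgrPdist_le => e e0.
have [k hk] : exists k : nat, k.+1%:R^-1 < e / 2.
  have [k _ hk] := near_infty_natSinv_lt (PosNum (divr_gt0 e0 (ltr0Sn _ 1))).
  by exists k; apply: hk => /=.
have [M _ hM] := hw k.
(* Taking [n >= k + 1] bounds the diagonal part [1 / n] by [1 / (k + 1)] too, so each part is at
   most [e / 2]. *)
exists (maxn M k.+1) => // n /=; rewrite geq_max => /andP[Mn kn].
have n0 : (0 < n)%N by rewrite (leq_trans _ kn).
have /andP[pn0 _] := hp n n0.
have [_ _ xi0] := hxi n n0.
have nk : n%:R^-1 <= k.+1%:R^-1 :> R.
  by rewrite lef_pV2 ?posrE ?ltr0n// ler_nat.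
set A := [set _ | _ in _ & _ in _].
have Ale x : A x -> x <= e.
  move=> [s hs [t ht <-]].
  apply: (le_trans (bilinear_form_le n0 pn0 xi0 (hM n Mn) hs ht)).
  by rewrite (splitr e) lerD ?(ltW hk)// (le_trans nk)// ltW.
(* Flipping the signs of [s] negates the form, so the upper bound over all signs is also a lower
   bound. *)
have Age x : A x -> - e <= x.
  move=> [s hs [t ht <-]]; rewrite lerNl; apply: Ale.
  exists (fun i => - s i); first exact: sign_vectorsN.
  exists t => //; rewrite -mulrN -sumrN; congr (_ * _); apply: eq_bigr => i _.
  by rewrite -sumrN; apply: eq_bigr => j _; rewrite mulrN mulNr.
(* Nonemptiness makes [sup] a genuine least upper bound: it is at most [e], and at least any
   element, hence at least [- e]. *)
have Ane : A !=set0.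
  eexists; exists (fun=> 1); [by move=> i; right|].
  by exists (fun=> 1); [by move=> i; right|reflexivity].
have [x Ax] := Ane.
rewrite sub0r normrN ler_norml ge_sup ?andbT//.
apply: le_trans (Age _ Ax) _; apply: ub_le_sup => //.
by exists e.
Qed.
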